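(* Let $n\ge3$, $l\in\{2,\dots,n-1\}$ and $k\in\mathbb{N}$ with $k\ge1$ and $k+l-1\le n$. Then $$P_n^{\mathrm{sep}}(A^{(n)}_{l;k})=\frac{|S^{\mathrm{sep}}_{n-l+1}|\,|S^{\mathrm{sep}}_l|}{|S^{\mathrm{sep}}_n|}.$$
   Context: $S_n$ is the set of permutations of $[n]=\{1,\dots,n\}$, written $\sigma=\sigma_1\sigma_2\cdots\sigma_n$. For $l\in\{2,\dots,n-1\}$ and $k\ge1$ with $k+l-1\le n$, $A^{(n)}_{l;k}\subset S_n$ is the set of $\sigma\in S_n$ for which there exists $a$ with $\{k,k+1,\dots,k+l-1\}=\{\sigma_a,\sigma_{a+1},\dots,\sigma_{a+l-1}\}$. A permutation is separable if it can be constructed from the singleton in $S_1$ by iterating direct sums and skew sums; equivalently (a known result), if it avoids both patterns $2413$ and $3142$. Here $\sigma\in S_n$ contains $\tau\in S_m$ as a pattern if there are indices $1\le i_1<\cdots<i_m\le n$ such that for all $1\le j,j'\le m$, $\sigma_{i_j}<\sigma_{i_{j'}}$ if and only if $\tau_j<\tau_{j'}$; otherwise $\sigma$ avoids $\tau$. $S_n^{\mathrm{sep}}$ is the set of separable permutations in $S_n$, and $P_n^{\mathrm{sep}}$ is the uniform probability measure on $S_n^{\mathrm{sep}}$, so $P_n^{\mathrm{sep}}(A)=|A\cap S_n^{\mathrm{sep}}|/|S_n^{\mathrm{sep}}|$ for $A\subset S_n$. *)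

(* Defs.v *)
From mathcomp Require Import all_boot all_order all_fingroup all_algebra.
From mathcomp Require Import boolp.

Set Implicit Arguments.
Unset Strict Implicit.
Unset Printing Implicit Defensive.

Import GRing.Theory.

(* A permutation s : 'S_n is read as the word s 0, s 1, ..., s (n - 1):
   positions and values are numbered from 0 to n - 1. *)

Section Sums.
Variables (m n : nat) (s : 'S_m) (t : 'S_n).

Definition dsum_fun (i : 'I_(m + n)) : 'I_(m + n) :=
  match split i with
  | inl j => lshift n (s j)
  | inr j => rshift m (t j)
  end.

Definition skew_fun (i : 'I_(m + n)) : 'I_(m + n) :=
  cast_ord (addnC n m)
    match split i with
    | inl j => rshift n (s j)
    | inr j => lshift m (t j)
    end.

Lemma dsum_inj : injective dsum_fun.
Proof.
move=> i i'; rewrite /dsum_fun -{2}(splitK i) -{2}(splitK i').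
case: (split i) => j; case: (split i') => j' /=.
- by move/lshift_inj/perm_inj ->.
- by move/eqP; rewrite eq_lrshift.
- by move/eqP; rewrite eq_rlshift.
- by move/rshift_inj/perm_inj ->.
Qed.

Lemma skew_inj : injective skew_fun.
Proof.
move=> i i'; rewrite /skew_fun -{2}(splitK i) -{2}(splitK i') => /cast_ord_inj.
case: (split i) => j; case: (split i') => j' /=.
- by move/rshift_inj/perm_inj ->.
- by move/eqP; rewrite eq_rlshift.
- by move/eqP; rewrite eq_lrshift.
- by move/lshift_inj/perm_inj ->.
Qed.

(* The word of s followed by the word of t, with t placed above s. *)
Definition direct_sum : 'S_(m + n) := perm dsum_inj.

(* The word of s followed by the word of t, with s placed above t. *)
Definition skew_sum : 'S_(m + n) := perm skew_inj.

End Sums.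

Inductive separable : forall n, 'S_n -> Prop :=
| separable1 : separable (1%g : 'S_1)
| separable_direct m n (s : 'S_m) (t : 'S_n) :
    separable s -> separable t -> separable (direct_sum s t)
| separable_skew m n (s : 'S_m) (t : 'S_n) :
    separable s -> separable t -> separable (skew_sum s t).

Definition Ssep n : {set 'S_n} := [set s | `[< separable s >]].

(* The law Psep below is thus a genuine probability for every n >= 1. *)
Lemma Ssep_gt0 n : 0 < #|Ssep n.+1|.
Proof.
apply/card_gt0P; suff [s sep_s] : exists s : 'S_n.+1, separable s.
  by exists s; rewrite inE; apply/asboolP.
elim: n => [|n [s sep_s]]; first by exists 1%g; apply: separable1.
exists (direct_sum (1%g : 'S_1) s).
exact: (separable_direct separable1 sep_s).
Qed.

Definition Psep n (A : {set 'S_n}) : rat :=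
  (#|A :&: Ssep n|%:R / #|Ssep n|%:R)%R.

(* The l consecutive values k, ..., k + l - 1, numbered from 1, occupy l
   consecutive positions; i.+1 is the value i : 'I_n numbered from 1. *)
Definition clustered n l k : {set 'S_n} :=
  [set s : 'S_n | [exists a : 'I_n,
     (a + l <= n) &&
     ([set s i | i : 'I_n & a <= i < a + l] ==
        [set i : 'I_n | k <= i.+1 <= k + l - 1])]].

(* Main.v *)
(* Read permutations as words. If the values k, ..., k + l - 1 occupy
   consecutive positions of w, then w is obtained from a permutation u of size
   n - l + 1 by substituting a copy of a permutation v of size l for the single
   letter k, and (u, v) is determined by w. Separability of words passes to
   nonempty subwords and to order-isomorphic words, so u and v are separable
   when w is; conversely it is preserved by inflating letters into separable
   words. Hence the clustered separable permutations are in bijection with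
   pairs of separable permutations of sizes n - l + 1 and l. *)

Require Import Defs.
From mathcomp Require Import all_boot all_order all_fingroup all_algebra.
From mathcomp Require Import boolp zify.

Set Implicit Arguments.
Unset Strict Implicit.
Unset Printing Implicit Defensive.

(** * Separable words over arbitrary letters *)

(** The letters need not form an initial segment, so the notion can pass to subwords and to
    increasing relabellings. The first disjunct plays the role of the direct sum, the second that of
    the skew sum; strictness makes the letters distinct. *)
Inductive separable_word : seq nat -> Prop :=
| separable_word1 x : separable_word [:: x]
| separable_word_cat u v :
    separable_word u -> separable_word v ->
    allrel ltn u v || allrel ltn v u -> separable_word (u ++ v).

(** A cut of [u] into a low and a high part induces the same kind of cut of the inflated word.
    Increasing relabellings are the case where every [r x] is a single letter. *)
Lemma separable_word_inflate (r : nat -> seq nat) u :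
    separable_word u -> {in u, forall x, separable_word (r x)} ->
    {in u &, forall x y, x < y -> allrel ltn (r x) (r y)} ->
  separable_word (flatten [seq r x | x <- u]).
Proof.
elim=> [x|u1 u2 _ IH1 _ IH2 lt12] rP ltr.
  by rewrite /= cats0; apply: rP; rewrite mem_head.
have s1 x : x \in u1 -> x \in u1 ++ u2 by rewrite mem_cat => ->.
have s2 x : x \in u2 -> x \in u1 ++ u2 by rewrite mem_cat orbC => ->.
have lt_flatten v1 v2 : {subset v1 <= u1 ++ u2} -> {subset v2 <= u1 ++ u2} ->
    allrel ltn v1 v2 ->
    allrel ltn (flatten [seq r x | x <- v1]) (flatten [seq r x | x <- v2]).
  move=> sv1 sv2 /allrelP ltv; apply/allrelP => a b.
  case/flatten_mapP=> x xv ax /flatten_mapP[y yv byr].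
  exact: (allrelP (ltr x y (sv1 _ xv) (sv2 _ yv) (ltv x y xv yv))).
rewrite map_cat flatten_cat; apply: separable_word_cat.
- by apply: IH1 => [x /s1/rP|x y /s1 xu /s1 yu] //; apply: ltr.
- by apply: IH2 => [x /s2/rP|x y /s2 xu /s2 yu] //; apply: ltr.
- by apply/orP; case/orP: lt12 => lt12; [left|right]; apply: lt_flatten.
Qed.

Lemma separable_word_map (f : nat -> nat) u :
    separable_word u -> {in u &, {homo f : x y / x < y}} ->
  separable_word [seq f x | x <- u].
Proof.
move=> sep_u lt_f; rewrite -flatten_map1.
apply: separable_word_inflate => // [x _|x y xu yu /lt_f ltxy].
  exact: separable_word1.
by rewrite allrel1l /= ltxy.
Qed.

Lemma separable_word_subseq u v :
  separable_word u -> subseq v u -> v != [::] -> separable_word v.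
Proof.
move=> sep_u; elim: sep_u v => [x|u1 u2 _ IH1 _ IH2 lt12] v.
  by case/subseqP => -[|[] [|? ?]] // _ -> // _; apply: separable_word1.
(* The selecting mask is cut at the length of [u1], so the subword splits along the same
   decomposition; if one half is empty, the other half is the whole subword. *)
case/subseqP => b sz_b ->{v}; rewrite -(cat_take_drop (size u1) b).
rewrite mask_cat ?size_takel ?sz_b ?size_cat ?leq_addr //.
set v1 := mask _ u1; set v2 := mask _ u2.
have sub1 : subseq v1 u1 by apply: mask_subseq.
have sub2 : subseq v2 u2 by apply: mask_subseq.
have [->|nz1] := eqVneq v1 [::]; first exact: IH2.
have [->|nz2] := eqVneq v2 [::]; first by rewrite cats0; apply: IH1.
move=> _; apply: separable_word_cat; [exact: IH1|exact: IH2|].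
case/orP: lt12 => /allrelP lt12; apply/orP; [left|right]; apply/allrelP => x y.
  by move=> /(mem_subseq sub1) xu /(mem_subseq sub2); apply: lt12.
by move=> /(mem_subseq sub2) xu /(mem_subseq sub1); apply: lt12.
Qed.

(** * Words of permutations and the separable ones among them *)

Definition word n (s : 'S_n) : seq nat := [seq val (s i) | i <- enum 'I_n].

Lemma size_word n (s : 'S_n) : size (word s) = n.
Proof. by rewrite size_map size_enum_ord. Qed.

Lemma nth_word n (s : 'S_n) (i : 'I_n) : nth 0 (word s) i = s i.
Proof. by rewrite (nth_map i) ?size_enum_ord ?ltn_ord // nth_ord_enum. Qed.

Lemma word_inj n : injective (@word n).
Proof.
move=> s t eq_st; apply/permP => i; apply: val_inj.
by rewrite /= -!nth_word eq_st.
Qed.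

Lemma perm_word n (s : 'S_n) : perm_eq (word s) (iota 0 n).
Proof.
apply: uniq_perm; rewrite ?iota_uniq //.
  by rewrite map_inj_uniq ?enum_uniq // => i j /val_inj/perm_inj.
move=> x; rewrite mem_iota; apply/mapP/idP => [[i _ ->]|/andP[_ ltxn]].
  by rewrite ltn_ord.
by exists (s^-1 (Ordinal ltxn))%g; rewrite ?mem_enum // permKV.
Qed.

Lemma mem_word n (s : 'S_n) x : (x \in word s) = (x < n).
Proof. by rewrite (perm_mem (perm_word s)) mem_iota. Qed.

Lemma word_direct_sum m n (s : 'S_m) (t : 'S_n) :
  word (direct_sum s t) = word s ++ [seq m + x | x <- word t].
Proof.
apply: (@eq_from_nth _ 0) => [|i]; rewrite !(size_word, size_cat, size_map) //.
move=> lti; rewrite -[i]/(val (Ordinal lti)) nth_word permE /dsum_fun.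
case: splitP => j /= ->; rewrite nth_cat size_word.
  by rewrite ltn_ord nth_word.
by rewrite ltnNge leq_addr addKn (nth_map 0) ?size_word ?ltn_ord // nth_word.
Qed.

Lemma word_skew_sum m n (s : 'S_m) (t : 'S_n) :
  word (skew_sum s t) = [seq n + x | x <- word s] ++ word t.
Proof.
apply: (@eq_from_nth _ 0) => [|i]; rewrite !(size_word, size_cat, size_map) //.
move=> lti; rewrite -[i]/(val (Ordinal lti)) nth_word permE /skew_fun.
case: splitP => j /= ->; rewrite nth_cat size_map size_word.
  by rewrite ltn_ord (nth_map 0) ?size_word ?ltn_ord // nth_word.
by rewrite ltnNge leq_addr addKn nth_word.
Qed.

Lemma separable_wordP n (s : 'S_n) :
  separable s -> separable_word (word s).
Proof.
elim=> [|{}m {}n' {}s t _ IHs _ IHt|{}m {}n' {}s t _ IHs _ IHt].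
- have:= size_word (1%g : 'S_1); case: word => [|x []] // _.
  exact: separable_word1.
- rewrite word_direct_sum; apply: separable_word_cat => //.
    by apply: separable_word_map => // x y _ _; rewrite ltn_add2l.
  apply/orP; left; apply/allrelP => x y; rewrite mem_word => ltx /mapP[z _ ->] /=.
  by apply: leq_trans ltx _; rewrite leq_addr.
- rewrite word_skew_sum; apply: separable_word_cat => //.
    by apply: separable_word_map => // x y _ _; rewrite ltn_add2l.
  apply/orP; right; apply/allrelP => x y; rewrite mem_word => ltx /mapP[z _ ->] /=.
  by apply: leq_trans ltx _; rewrite leq_addr.
Qed.

(** Converse of [separable_wordP] up to standardization: the pieces of a permutation's word need not
    be words of permutations, so the induction carries an increasing relabelling [f]. *)
Lemma separable_word_pattern w : separable_word w ->
  exists n (s : 'S_n) (f : nat -> nat), [/\ separable s,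
    w = [seq f x | x <- word s] & {in word s &, {homo f : x y / x < y}}].
Proof.
elim=> [x|u v _ [m [s [f [sep_s -> ltf]]]] _ [n [t [g [sep_t -> ltg]]]]].
  exists 1, 1%g, (fun=> x); split; first exact: separable1.
    by have:= size_word (1%g : 'S_1); case: word => [|y []].
  by move=> a b; rewrite !mem_word; lia.
case/orP => /allrelP ltuv.
(* The two relabellings are glued at [m]; the glued map increases across [m] because [u] lies below
   [v]. *)
- exists (m + n), (direct_sum s t), (fun x => if x < m then f x else g (x - m)).
  split; first exact: separable_direct.
    rewrite word_direct_sum map_cat -map_comp; congr (_ ++ _).
      by apply/eq_in_map => x; rewrite mem_word => ->.
    by apply/eq_in_map => x _ /=; rewrite ltnNge leq_addr addKn.
  move=> x y; rewrite !mem_word => ltx lty ltxy.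
  case: (ltnP x m) => xm; case: (ltnP y m) => ym; try lia.
  + by apply: ltf; rewrite ?mem_word.
  + by apply: ltuv; apply: map_f; rewrite mem_word //; lia.
  + by apply: ltg; rewrite ?mem_word; lia.
(* Here the low letters of the sum come from [t], so [g] acts below [n] and [f] acts after a
   shift. *)
- exists (m + n), (skew_sum s t), (fun x => if x < n then g x else f (x - n)).
  split; first exact: separable_skew.
    rewrite word_skew_sum map_cat -map_comp; congr (_ ++ _).
      by apply/eq_in_map => x _ /=; rewrite ltnNge leq_addr addKn.
    by apply/eq_in_map => x; rewrite mem_word => ->.
  move=> x y; rewrite !mem_word => ltx lty ltxy.
  case: (ltnP x n) => xn; case: (ltnP y n) => yn; try lia.
  + by apply: ltg; rewrite ?mem_word.
  + by apply: ltuv; apply: map_f; rewrite mem_word //; lia.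
  + by apply: ltf; rewrite ?mem_word; lia.
Qed.

(* Listing words instead of permutations removes the dependency on n: the
   bijection becomes a [perm_eq] between lists of words. *)
Definition Wsep n : seq (seq nat) := [seq word s | s <- enum (Ssep n)].

Lemma size_Wsep n : size (Wsep n) = #|Ssep n|.
Proof. by rewrite size_map cardE. Qed.

Lemma uniq_Wsep n : uniq (Wsep n).
Proof. by rewrite map_inj_uniq ?enum_uniq //; apply: word_inj. Qed.

Lemma WsepP n w :
  reflect (perm_eq w (iota 0 n) /\ separable_word w) (w \in Wsep n).
Proof.
apply: (iffP mapP) => [[s]|[perm_w /separable_word_pattern[m [s [f [sep_s def_w ltf]]]]]].
  rewrite mem_enum inE => /asboolP sep_s ->.
  by split; [apply: perm_word|apply: separable_wordP].
have eq_mn : m = n by have:= perm_size perm_w; rewrite def_w size_map size_word size_iota.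
case: n / eq_mn in perm_w *.
have perm_f : perm_eq [seq f x | x <- iota 0 m] (iota 0 m).
  by apply: perm_trans perm_w; rewrite def_w perm_map // perm_sym perm_word.
exists s; first by rewrite mem_enum inE; apply/asboolP.
(* An increasing [f] that permutes the values below [m] is the identity there: its list of values is
   sorted and has the same members as [iota 0 m]. *)
have /eq_in_map eqf : [seq f x | x <- iota 0 m] = [seq id x | x <- iota 0 m].
  rewrite map_id; apply: (irr_sorted_eq ltn_trans ltnn) (iota_ltn_sorted _ _) (perm_mem perm_f).
  apply: (homo_sorted_in ltf) (iota_ltn_sorted _ _).
  by apply/allP => x; rewrite -(perm_mem (perm_word s)).
rewrite def_w -[RHS]map_id.
by apply/eq_in_map => x; rewrite (perm_mem (perm_word s)); apply: eqf.
Qed.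

(** * Blocks of consecutive values and the inflation of a letter into a block *)

Definition block l k (w : seq nat) :=
  exists u v1 v2, w = v1 ++ u ++ v2 /\ perm_eq u (iota k l).

(** The predecessor of [k] passes from values numbered from 1 to letters numbered from 0. *)
Lemma clusteredP n l k (s : 'S_n) : 0 < l -> 0 < k ->
  s \in clustered n l k <-> block l k.-1 (word s).
Proof.
move=> l_gt0 k_gt0; rewrite inE; split.
  case/existsP => a /andP[le_an /eqP im_s].
  exists (take l (drop a (word s))), (take a (word s)), (drop l (drop a (word s))).
  rewrite !cat_take_drop; split=> //.
  have sz_v : size (take l (drop a (word s))) = l.
    by rewrite size_takel // size_drop size_word; lia.
  have uniq_v : uniq (take l (drop a (word s))).
    by rewrite take_uniq // drop_uniq // (perm_uniq (perm_word s)) iota_uniq.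
  have sub_v : {subset take l (drop a (word s)) <= iota k.-1 l}.
    move=> x /(nthP 0)[i]; rewrite sz_v => lt_il <-.
    have lt_ain : a + i < n by lia.
    rewrite nth_take // nth_drop -[a + i]/(val (Ordinal lt_ain)) nth_word.
    have: s (Ordinal lt_ain) \in [set s i | i : 'I_n & a <= i < a + l].
      by apply: imset_f; rewrite inE /=; lia.
    by rewrite im_s inE mem_iota; lia.
  (* A window of [l] distinct letters inside a set of [l] values exhausts that set. *)
  have [|_ eq_v] := uniq_min_size uniq_v sub_v; first by rewrite size_iota sz_v.
  by apply: uniq_perm; rewrite ?iota_uniq.
case=> u [v1 [v2 [def_w perm_u]]].
have sz_u : size u = l by rewrite (perm_size perm_u) size_iota.
have sz_w : size v1 + (l + size v2) = n.
  by rewrite -[n in RHS](size_word s) def_w !size_cat sz_u.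
have lt_v1n : size v1 < n by lia.
have nth_u (i : 'I_n) : size v1 <= i < size v1 + l ->
    s i = nth 0 u (i - size v1) :> nat.
  move=> lt_i; rewrite -nth_word def_w nth_cat ifF; last by lia.
  by rewrite nth_cat ifT //; lia.
apply/existsP; exists (Ordinal lt_v1n); apply/andP; split; first by rewrite /=; lia.
apply/eqP/setP => x; rewrite inE.
have ->: (k <= x.+1 <= k + l - 1) = ((x : nat) \in u).
  by rewrite (perm_mem perm_u) mem_iota; lia.
apply/imsetP/idP => [[i] | /(nthP 0)[i]].
  by rewrite inE /= => lt_i ->; rewrite nth_u // mem_nth // sz_u; lia.
rewrite sz_u => lt_i def_x; have lt_in : size v1 + i < n by lia.
exists (Ordinal lt_in); first by rewrite inE /=; lia.
by apply: val_inj; rewrite /= nth_u /= ?addKn ?def_x //; lia.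
Qed.

(* [spread] makes room above the letter k for l - 1 new values; the letter k
   itself is the one to be inflated, so its image is irrelevant. *)
Definition spread l k x := if x < k then x else x + l.-1.

(** Contracts the whole interval of [l] values from [k] on to the letter [k], and undoes [spread] on
    the other letters. *)
Definition collapse l k x := if x < k then x else if x < k + l then k else x - l.-1.

Definition inflate l k (u v : seq nat) : seq nat :=
  flatten [seq if x == k then [seq k + y | y <- v] else [:: spread l k x] | x <- u].

Lemma inflate_pivot l k u1 u2 v : k \notin u1 -> k \notin u2 ->
  inflate l k (u1 ++ k :: u2) v =
  [seq spread l k x | x <- u1] ++ [seq k + y | y <- v] ++
  [seq spread l k x | x <- u2].
Proof.
move=> nku1 nku2; rewrite /inflate map_cat flatten_cat /= eqxx.
have off u : k \notin u ->
    flatten [seq if x == k then [seq k + y | y <- v] else [:: spread l k x]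
            | x <- u] = [seq spread l k x | x <- u].
  elim: u => //= x u IHu; rewrite inE negb_or eq_sym => /andP[/negPf-> nku].
  by rewrite IHu.
by rewrite !off.
Qed.

Lemma spread_inj l k : injective (spread l k).
Proof. by move=> x y; rewrite /spread; case: (ltnP x) => ?; case: (ltnP y) => ?; lia. Qed.

Lemma spread_iota l k r : 0 < l ->
  [seq spread l k x | x <- iota 0 k ++ iota k.+1 r] = iota 0 k ++ iota (k + l) r.
Proof.
move=> l_gt0; rewrite map_cat -[in RHS](prednK l_gt0) addnS -addSn addnC iotaDl.
congr (_ ++ _); first apply: map_id_in; last apply/eq_in_map; move=> x;
  rewrite mem_iota /spread; case: ifP; lia.
Qed.

Lemma spreadK l k x : 0 < l -> x != k -> collapse l k (spread l k x) = x.
Proof.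
by move=> l_gt0 nxk; rewrite /collapse /spread; repeat case: ifP; lia.
Qed.

Lemma collapse_iota l k r : 0 < l ->
  [seq collapse l k x | x <- iota 0 k ++ iota (k + l) r] = iota 0 k ++ iota k.+1 r.
Proof.
move=> l_gt0; rewrite -spread_iota // -map_comp; apply: map_id_in => x.
by rewrite mem_cat !mem_iota => x_off; apply: spreadK => //; lia.
Qed.

Lemma iota_pivot n l k : k + l <= n ->
  iota 0 n = iota 0 k ++ iota k l ++ iota (k + l) (n - (k + l)).
Proof. by move=> le_n; rewrite -iotaD -iotaD addnA subnKC. Qed.

(** The block cancels on both sides. With the one-letter case [perm_pivot], this reduces both words
    to their letters outside the block or pivot, which [spread] and [collapse] exchange. *)
Lemma perm_block n l k u v1 v2 : k + l <= n -> perm_eq u (iota k l) ->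
  perm_eq (v1 ++ u ++ v2) (iota 0 n) =
  perm_eq (v1 ++ v2) (iota 0 k ++ iota (k + l) (n - (k + l))).
Proof.
move=> le_n perm_u; rewrite (iota_pivot le_n) perm_catCA perm_sym perm_catCA.
by rewrite perm_sym (permPl (perm_cat perm_u (perm_refl _))) perm_cat2l.
Qed.

Lemma perm_pivot n k v1 v2 : k < n ->
  perm_eq (v1 ++ k :: v2) (iota 0 n) =
  perm_eq (v1 ++ v2) (iota 0 k ++ iota k.+1 (n - k.+1)).
Proof.
by move=> lt_kn; rewrite -cat1s (@perm_block n 1 k [:: k]) ?addn1.
Qed.

Lemma Wsep_pivot n u k : k < n -> u \in Wsep n ->
  exists u1 u2, [/\ u = u1 ++ k :: u2, k \notin u1 & k \notin u2].
Proof.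
move=> lt_kn /WsepP[perm_u _].
have uniq_u : uniq u by rewrite (perm_uniq perm_u) iota_uniq.
have ku : k \in u by rewrite (perm_mem perm_u) mem_iota.
case/splitPr: ku uniq_u => u1 u2; rewrite uniq_catC /= mem_cat negb_or.
by case/andP => /andP[ku2 ku1] _; exists u1, u2.
Qed.


(** * Inflation as a bijection on separable words *)

Lemma inflate_Wsep n l k u v : 0 < l -> k + l <= n ->
    u \in Wsep (n - l + 1) -> v \in Wsep l ->
  inflate l k u v \in Wsep n /\ block l k (inflate l k u v).
Proof.
move=> l_gt0 le_n uW vW; have [|u1 [u2 [def_u ku1 ku2]]] := Wsep_pivot _ uW (k := k).
  by lia.
have [perm_u sep_u] := WsepP _ _ uW; have [perm_v sep_v] := WsepP _ _ vW.
have perm_kv : perm_eq [seq k + y | y <- v] (iota k l).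
  by rewrite -[X in iota X](addn0 k) iotaDl perm_map.
have lt_v y : y \in v -> y < l by rewrite (perm_mem perm_v) mem_iota.
split; last first.
  by rewrite def_u inflate_pivot //; do 3!eexists; split; first reflexivity.
apply/WsepP; split.
  rewrite def_u inflate_pivot // (perm_block _ _ le_n perm_kv) -map_cat.
  move: perm_u; rewrite def_u perm_pivot; last by lia.
  by move/(perm_map (spread l k)); rewrite spread_iota //; congr perm_eq; congr cat; congr iota; lia.
apply: separable_word_inflate => // [x _|x y _ _ lt_xy].
  case: eqP => _; last exact: separable_word1.
  by apply: separable_word_map => // y z _ _; rewrite ltn_add2l.
(* The letters of the block lie between [k] and [k + l - 1], exactly the gap left by [spread], so
   the order of distinct letters of [u] is kept. *)
apply/allrelP => a b; rewrite /spread.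
case: (eqVneq x k) => nxk; case: (eqVneq y k) => nyk.
- by lia.
- by case/mapP=> z /lt_v lt_z -> ; rewrite inE => /eqP-> /=; case: ifP; lia.
- by rewrite inE => /eqP-> /mapP[z _ ->] /=; case: ifP; lia.
- by rewrite !inE => /eqP-> /eqP-> /=; repeat case: ifP; lia.
Qed.

(** Both factors are increasing relabellings of subwords of [w]: [v] comes from the block itself,
    and [u] from [w] with the block cut down to one representative. *)
Lemma Wsep_block_inflate n l k w : 0 < l -> k + l <= n ->
    w \in Wsep n -> block l k w ->
  exists u v, [/\ u \in Wsep (n - l + 1), v \in Wsep l & w = inflate l k u v].
Proof.
move=> l_gt0 le_n /WsepP[perm_w sep_w] [v [w1 [w2 [def_w perm_v]]]].
have perm_w12 : perm_eq (w1 ++ w2) (iota 0 k ++ iota (k + l) (n - (k + l))).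
  by rewrite -(perm_block _ _ le_n perm_v) -def_w.
have off_block x : x \in w1 ++ w2 -> (x < k) || (k + l <= x).
  by rewrite (perm_mem perm_w12) mem_cat !mem_iota; lia.
have in_block x : x \in v -> k <= x < k + l by rewrite (perm_mem perm_v) mem_iota.
(* Since [l] is positive, the block has a first letter [z], taken as its representative. *)
have [z [v' def_v]] : exists z v', v = z :: v'.
  case: (v) (perm_size perm_v) => [|z v' _]; last by exists z, v'.
  by rewrite size_iota /=; lia.
have zv : z \in v by rewrite def_v mem_head.
have zP := in_block z zv.
have collapse_z : collapse l k z = k by rewrite /collapse; repeat case: ifP; lia.
have collapseK x : x \in w1 ++ w2 -> spread l k (collapse l k x) = x.
  by move/off_block; rewrite /spread /collapse; repeat (case: ifP); lia.
have collapse_off x : x \in w1 ++ w2 -> collapse l k x != k.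
  by move/off_block; rewrite /collapse; repeat (case: ifP); lia.
exists [seq collapse l k x | x <- w1 ++ z :: w2], [seq y - k | y <- v]; split.
- apply/WsepP; split.
    rewrite map_cat /= collapse_z perm_pivot -?map_cat; last by lia.
    have:= perm_map (collapse l k) perm_w12; rewrite collapse_iota //.
    by congr perm_eq; congr cat; congr iota; lia.
  apply: separable_word_map => [|x y].
    apply: separable_word_subseq sep_w _ _; last by case: (w1).
    by rewrite def_w cat_subseq // def_v /= eqxx suffix_subseq.
  (* [collapse] is strictly increasing here only because [z] is the sole letter kept from the
     block. *)
  have collapseP t : t \in w1 ++ z :: w2 -> t = z \/ (t < k) || (k + l <= t).
    rewrite mem_cat inE orbCA -mem_cat => /orP[/eqP|/off_block]; by [left|right].
  move=> /collapseP xP /collapseP yP lt_xy; rewrite /collapse.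
  by repeat case: ifP; lia.
- apply/WsepP; split.
    have:= perm_map (subn^~ k) perm_v; congr perm_eq.
    by rewrite -[X in iota X](addn0 k) iotaDl -map_comp map_id_in // => x _ /=; rewrite addKn.
  apply: separable_word_map => [|x y /in_block xP /in_block yP lt_xy]; last by lia.
  apply: separable_word_subseq sep_w _ _; last by rewrite def_v.
  by rewrite def_w; apply: subseq_trans (suffix_subseq _ _); apply: prefix_subseq.
- rewrite map_cat /= collapse_z inflate_pivot.
  + rewrite -!map_comp def_w; congr (_ ++ (_ ++ _)); rewrite map_id_in // => x xw /=.
    * by rewrite collapseK // mem_cat xw.
    * by rewrite subnKC //; have /andP[] := in_block x xw.
    * by rewrite collapseK // mem_cat xw orbT.
  + by apply/mapP => -[x xw /eqP]; rewrite eq_sym (negPf (collapse_off _ _)) // mem_cat xw.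
  + by apply/mapP => -[x xw /eqP]; rewrite eq_sym (negPf (collapse_off _ _)) // mem_cat xw orbT.
Qed.

(** The first letter with value in the block marks the end of the prefix, so the inflated word
    determines where to cut; each of the three pieces is then recovered by an injective
    relabelling. *)
Lemma inflate_inj n l k u v u' v' : 0 < l -> k + l <= n ->
    u \in Wsep (n - l + 1) -> v \in Wsep l ->
    u' \in Wsep (n - l + 1) -> v' \in Wsep l ->
  inflate l k u v = inflate l k u' v' -> u = u' /\ v = v'.
Proof.
move=> l_gt0 le_n uW vW u'W v'W.
have size_pivot u1 u2 x : k \notin u1 -> x \in Wsep l ->
    find [pred y | k <= y < k + l]
      ([seq spread l k y | y <- u1] ++ [seq k + y | y <- x] ++ u2) = size u1.
  move=> ku1 /WsepP[perm_x _]; rewrite find_cat ifF.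
    rewrite size_map; case: x perm_x => [/perm_size|y x perm_x].
      by rewrite size_iota /=; lia.
    have: y \in iota 0 l by rewrite -(perm_mem perm_x) mem_head.
    by rewrite mem_iota => lt_y; rewrite /= ifT ?addn0 //; lia.
  apply/hasP => -[_ /mapP[y yu1 ->]] /=.
  have: y != k by apply: contraNneq ku1 => <-.
  by rewrite /spread; case: ifP; lia.
have [|u1 [u2 [-> ku1 ku2]]] := Wsep_pivot _ uW (k := k); first by lia.
have [|u1' [u2' [-> ku1' ku2']]] := Wsep_pivot _ u'W (k := k); first by lia.
rewrite !inflate_pivot // => eq_w.
have sz1 : size u1 = size u1'.
  by rewrite -(size_pivot u1 [seq spread l k x | x <- u2] v) // eq_w size_pivot.
have szv x : x \in Wsep l -> size x = l.
  by case/WsepP => /perm_size; rewrite size_iota.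
move/eqP: eq_w; rewrite !eqseq_cat ?size_map ?(szv v) ?(szv v') //.
case/and3P=> /eqP/(inj_map (@spread_inj l k))-> /eqP/(inj_map (@addnI k))->.
by move/eqP/(inj_map (@spread_inj l k))->.
Qed.

(** * Counting clustered separable permutations *)

Lemma card_clustered_Ssep n l k : 0 < l -> 0 < k -> k + l - 1 <= n ->
  #|clustered n l k :&: Ssep n| = #|Ssep (n - l + 1)| * #|Ssep l|.
Proof.
move=> l_gt0 k_gt0 le_n; have{}le_n : k.-1 + l <= n by lia.
(* Both counts become lengths of duplicate-free lists of words, one of clustered permutations and
   one of inflations of all pairs, so equal membership suffices. *)
rewrite -!size_Wsep -(size_allpairs (inflate l k.-1)).
rewrite cardE -(size_map (@word n)); apply: perm_size; apply: uniq_perm.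
- by rewrite map_inj_uniq ?enum_uniq //; apply: word_inj.
- apply: allpairs_uniq; rewrite ?uniq_Wsep // => -[u v] [u' v'].
  case/allpairsP => -[? ?] /= [uW vW [-> ->]] /allpairsP[[? ?] /= [u'W v'W [-> ->]]].
  by move/(inflate_inj l_gt0 le_n uW vW u'W v'W) => [-> ->].
move=> w; apply/mapP/allpairsP => [[s]|[[u v] /= [uW vW ->]]].
  rewrite mem_enum inE => /andP[/clusteredP block_s sep_s] ->.
  have sW : word s \in Wsep n by rewrite map_f ?mem_enum.
  have [u [v [uW vW def_s]]] := Wsep_block_inflate l_gt0 le_n sW (block_s l_gt0 k_gt0).
  by exists (u, v).
have [/mapP[s]] := inflate_Wsep l_gt0 le_n uW vW; rewrite mem_enum => sep_s -> block_s.
by exists s; rewrite // mem_enum inE sep_s andbT; apply/clusteredP.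
Qed.

Theorem theorem2 (n l k : nat) (hn : (3 <= n)%N) (hl : (2 <= l <= n - 1)%N)
    (hk : (1 <= k)%N) (hkl : (k + l - 1 <= n)%N) :
  Psep (clustered n l k) =
    (#|Ssep (n - l + 1)|%:R * #|Ssep l|%:R / #|Ssep n|%:R)%R.
Proof.
by rewrite /Psep card_clustered_Ssep ?GRing.natrM //; lia.
Qed.
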